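(* Let $\mathcal R$, $u^*$, $C$, $\alpha$, $M$, $\xi^*$, $\mu$, $\beta$, $\xi$ be as in the context. Let $r \in (1,2]$, let $\phi$ be a decreasing function of the Newton iteration count $\nu = 0,1,2,\ldots$ with $\phi(0) = \phi_0 < 1$, let $\eta_0 \in [0,1)$, and let $u^0 \in B_\xi(u^* )$ be an initial guess. Let $\theta$ be a sufficiently small strictly positive constant such that - $\eta_0 + \beta\theta^\alpha \le \eta_0^{1/r}$, - $\theta < \xi/\mu$, - $\|\mathcal R(u^0)\| \le \theta$. Then the iterates $u^\nu$, $\nu = 1,2,\ldots$, produced by the inexact Newton method started at $u^0$ with initial forcing term $\eta_0$ and forcing terms $$\eta_\nu = \phi(\nu) \left(\frac{\|\mathcal{R}(u^\nu)\|}{\|\mathcal{R}(u^{\nu - 1})\|}\right)^r, \qquad \nu = 1,2,\ldots,$$ remain within $B_{\xi^*}(u^* )$ and converge to $u^*$ with q-order $r$.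
   Context: Standing assumptions. $\|\cdot\|$ is a norm on $\mathbb{R}^n$, and also denotes the induced operator norm on matrices. $B_\xi(u^* ) = \{u \in \mathbb{R}^n : \|u-u^*\| < \xi\}$. $\mathcal R : D \subset \mathbb{R}^n \to \mathbb{R}^n$, with Jacobian $\mathcal R'$; $u^* \in \mathbb{R}^n$ satisfies $\mathcal R(u^* ) = 0$. $C$ and $\alpha$ are non-negative real constants (usually $\alpha \in (0,1]$; $\alpha=1$ is the Lipschitz case), and $M = \max\{\|\mathcal R'(u^* )\|, \|\mathcal R'(u^* )^{-1}\|\}$. $\xi^*$ is a sufficiently small strictly positive constant such that: (i) $\mathcal R$ is continuously differentiable and $\mathcal R'(u)$ is nonsingular on $B_{\xi^*}(u^* )$; (ii) (Hölder condition at $u^*$) $\|\mathcal R'(u) - \mathcal R'(u^* )\| \le C\|u-u^*\|^\alpha$ for $u \in B_{\xi^*}(u^* )$; (iii) $\|\mathcal R'(u)^{-1}\| \le (\alpha+1)M$ for $u \in B_{\xi^*}(u^* )$; (iv) $\xi^* < \dfrac{\alpha+1}{CM}$. Constants. $\mu > 0$ is a constant such that $\frac1\mu\|u-u^*\| \le \|\mathcal R(u)\| \le \mu\|u-u^*\|$ for all $u \in B_{\xi^*}(u^* )$. $\beta>0$ is a constant such that $\|\mathcal R(u+\delta)\| \le (\eta+\beta\|\mathcal R(u)\|^\alpha)\|\mathcal R(u)\|$ whenever $u\in B_{\xi^*}(u^* )$, $\eta\in[0,1)$ and $\|\mathcal R(u)+\mathcal R'(u)\delta\|\le\eta\|\mathcal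 R(u)\|$; concretely $\beta = 2MC\left( 2\mu^\alpha(\alpha + 1) + (2(\alpha + 1)M)^\alpha\right)$. $\xi$ satisfies $0 < \xi \le \xi^*/(1 + 2(\alpha+1)M\mu)$. Inexact Newton method. Given $u^0$, for $\nu = 0,1,2,\ldots$ one takes a forcing term $\eta_\nu \in [0,1)$ and a vector $\delta^\nu$ with $\|\mathcal R(u^\nu) + \mathcal R'(u^\nu)\delta^\nu\| \le \eta_\nu \|\mathcal R(u^\nu)\|$, and sets $u^{\nu+1} = u^\nu + \delta^\nu$. A sequence $u^\nu \to u^*$ converges with q-order $r$ if there is a constant $K \ge 0$ such that $\|u^{\nu+1}-u^*\| \le K\|u^\nu-u^*\|^r$ for all sufficiently large $\nu$.
   Formalization: The q-order r claim is proved only for r ≤ 1+α (automatic when α = 1), because for r > 1+α it is false: R(u) = u + |u|^{1+α} with exact Newton steps has order exactly 1+α; containment and convergence hold for all r in (1,2]. *)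

(* Defs.v *)
From HB Require Import structures.
From mathcomp Require Import all_boot all_order all_algebra.
From mathcomp Require Import all_classical all_reals all_analysis.
Import Order.TTheory GRing.Theory Num.Theory.
Import numFieldNormedType.Exports.

Set Implicit Arguments.
Unset Strict Implicit.
Unset Printing Implicit Defensive.

Local Open Scope classical_set_scope.
Local Open Scope ring_scope.

(* Vectors of R^n are rows, as in the library's Jacobian ['J F u]: the
   directional derivative F'(u) v is [v *m 'J F u], and the operator norm
   below is that of the map [v |-> v *m A].
   The norm N is arbitrary; differentiability, continuity and convergence are
   those of the library's topology on ['rV_n], which every norm on R^n
   induces. *)

Definition is_norm (R : realType) (n : nat) (N : 'rV[R]_n -> R) : Prop :=
  [/\ forall x, N x = 0 -> x = 0,
      forall x y, N (x + y) <= N x + N y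
    & forall a x, N (a *: x) = `|a| * N x].

Definition opnorm (R : realType) (n : nat) (N : 'rV[R]_n -> R)
    (A : 'M[R]_n) : R :=
  sup [set N (v *m A) | v in [set v | N v <= 1]].

Definition nball (R : realType) (n : nat) (N : 'rV[R]_n -> R)
    (c : 'rV[R]_n) (rho : R) : set 'rV[R]_n :=
  [set u | N (u - c) < rho].

(* The requirement 0 <= eta k < 1 on forcing terms is kept apart. *)
Definition inexact_newton (R : realType) (n : nat) (N : 'rV[R]_n -> R)
    (F : 'rV[R]_n -> 'rV[R]_n) (eta : nat -> R) (delta u : nat -> 'rV[R]_n) :
    Prop :=
  forall k : nat,
    N (F (u k) + delta k *m 'J F (u k)) <= eta k * N (F (u k)) /\
    u k.+1 = u k + delta k.

Definition q_order (R : realType) (n : nat) (N : 'rV[R]_n -> R)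
    (u : nat -> 'rV[R]_n) (l : 'rV[R]_n) (r : R) : Prop :=
  exists2 K : R, 0 <= K &
    \forall k \near \oo, N (u k.+1 - l) <= K * N (u k - l) `^ r.

(* Main.v *)
Require Import Defs.
From HB Require Import structures.
From mathcomp Require Import all_boot all_order all_algebra.
From mathcomp Require Import all_classical all_reals all_analysis.
From mathcomp Require Import ring lra.
Import Order.TTheory GRing.Theory Num.Theory.
Import numFieldNormedType.Exports.

Set Implicit Arguments.
Unset Strict Implicit.
Unset Printing Implicit Defensive.

Local Open Scope classical_set_scope.
Local Open Scope ring_scope.

(** Write f_k = N (F (u k)) for the residuals and q = eta_0 `^ r^-1 < 1.

    As long as the forcing term does not exceed eta_0 and the residual does not
    exceed theta, the choice of theta turns the Newton estimate
    f_(k+1) <= (eta_k + beta f_k `^ alpha) f_k into f_(k+1) <= q f_k.  The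
    residual then stays below theta, and the next forcing term
    phi_(k+1) (f_(k+1) / f_k) `^ r is at most q `^ r = eta_0, so the bounds
    reproduce themselves.  Since the residual is comparable to the error,
    f_k <= theta < xi / mu keeps u k in the ball of radius xi; a Newton step
    has length at most 2 (alpha + 1) M f_k ([inexact_newton_step_le]), so it
    cannot leave the ball of radius xistar, where the Newton estimate applies.
    Geometric decay of f_k gives convergence in N, and equivalence of norms
    ([mx_norm_le_is_norm]) convergence in the topology of R^n.

    For the order, put K_k = f_(k+1) / f_k `^ r.  With r <= 1 + alpha, the
    forcing terms give K_(k+1) <= p K_k + beta theta `^ (1 + alpha - r), where
    p < 1 bounds phi; such a sequence is bounded ([forcing_residual_order]).
    The residuals thus converge with order r, hence so do the errors. *)

(** * Norms on row vectors and their operator norms *)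

Lemma is_norm0 (R : realType) (n : nat) (N : 'rV[R]_n -> R) :
  is_norm N -> N 0 = 0.
Proof. by case=> _ _ NZ; rewrite -(scale0r 0) NZ normr0 mul0r. Qed.

Lemma is_normN (R : realType) (n : nat) (N : 'rV[R]_n -> R) (x : 'rV[R]_n) :
  is_norm N -> N (- x) = N x.
Proof. by case=> _ _ NZ; rewrite -scaleN1r NZ normrN normr1 mul1r. Qed.

Lemma is_norm_ge0 (R : realType) (n : nat) (N : 'rV[R]_n -> R)
    (x : 'rV[R]_n) : is_norm N -> 0 <= N x.
Proof.
move=> hN; have [_ ND _] := hN.
have := ND x (- x); rewrite subrr (is_norm0 hN) (is_normN _ hN); lra.
Qed.

Lemma is_norm_sum (R : realType) (n : nat) (N : 'rV[R]_n -> R) (I : finType)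
    (G : I -> 'rV[R]_n) : is_norm N -> N (\sum_i G i) <= \sum_i N (G i).
Proof.
move=> hN; have [_ ND _] := hN.
apply: (big_ind2 (fun x y => N x <= y)) => [|x a y b xa yb|//].
  by rewrite is_norm0.
exact: le_trans (ND _ _) (lerD xa yb).
Qed.

(** The rows of A are the images of the basis vectors, and the coordinates of v
    are bounded by the supremum norm.  For A = 1 this compares N itself with the
    supremum norm. *)
Lemma is_norm_mulmx_le (R : realType) (n : nat) (N : 'rV[R]_n -> R)
    (A : 'M[R]_n) (v : 'rV[R]_n) :
  is_norm N -> N (v *m A) <= (\sum_i N (row i A)) * `|v|.
Proof.
move=> hN; have [_ _ NZ] := hN.
rewrite mulmx_sum_row (le_trans (is_norm_sum _ hN))// mulr_suml ler_sum// => i _.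
rewrite NZ mulrC ler_wpM2l ?is_norm_ge0//.
rewrite [leRHS]/Num.Def.normr /= mx_normrE; apply/bigmax_geP; right => /=.
by exists (0, i).
Qed.

Lemma is_norm_continuous (R : realType) (n : nat) (N : 'rV[R]_n -> R) :
  is_norm N -> continuous N.
Proof.
move=> hN x; have [_ ND _] := hN.
set c := \sum_i N (row i (1%:M : 'M[R]_n)).
have Nc v : N v <= (c + 1) * `|v|.
  rewrite -{1}[v]mulmx1 (le_trans (is_norm_mulmx_le _ _ hN))//.
  by rewrite ler_wpM2r// lerDl.
have c0 : 0 < c + 1 by rewrite ltr_wpDl// sumr_ge0// => i _; exact: is_norm_ge0.
have lip y : `|N x - N y| <= (c + 1) * `|x - y|.
  have xy := ND (x - y) y; have yx := ND (y - x) x.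
  rewrite !subrK in xy yx; rewrite -opprB is_normN// in yx.
  have := Nc (x - y); rewrite ler_norml; lra.
apply/(@cvgrPdist_lt _ _ _ (nbhs x)) => e e0.
have /cvgrPdist_lt/(_ _ (divr_gt0 e0 c0)) : y @[y --> x] --> x by exact: cvg_id.
apply: filterS => y; rewrite ltr_pdivlMr// mulrC.
exact: le_lt_trans (lip y).
Qed.

(** The nontrivial half of the equivalence of norms: N attains its minimum on
    the unit sphere of the supremum norm, which is compact, and this minimum is
    positive. *)
Lemma mx_norm_le_is_norm (R : realType) (n : nat) (N : 'rV[R]_n -> R) :
  is_norm N -> exists2 c : R, 0 <= c & forall x, `|x| <= c * N x.
Proof.
move=> hN; have [N0 _ NZ] := hN.
pose S := [set x : 'rV[R]_n | `|x| = 1].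
have unitS x : x != 0 -> S (`|x|^-1 *: x).
  by move=> x0; rewrite /S /= normrZ normfV normr_id mulVf// normr_eq0.
(* In dimension 0 the unit sphere is empty and has no minimizer. *)
have [S0|/set0P S0] := eqVneq S set0.
  exists 0 => // x; have [->|/unitS] := eqVneq x 0; first by rewrite normr0 mul0r.
  by rewrite S0.
have cS : compact S.
  apply: bounded_closed_compact.
    by exists 1; split => // y y1 x; rewrite /S /= => ->; exact: ltW.
  have -> : S = (fun x : 'rV[R]_n => `|x|) @^-1` [set 1] by [].
  apply: closed_comp; last exact: closed_eq.
  by move=> x _; exact: norm_continuous.
have [z /set_mem zS zmin] := EVT_min_rV S0 cS
  (continuous_subspaceT (is_norm_continuous hN)).
have Nz : 0 < N z.
  rewrite lt_neqAle is_norm_ge0// andbT eq_sym; apply/eqP => /N0 z0.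
  by move: zS; rewrite z0 /S /= normr0 => /eqP; rewrite eq_sym oner_eq0.
exists (N z)^-1 => [|x]; first by rewrite invr_ge0 ltW.
have [->|x0] := eqVneq x 0; first by rewrite normr0 is_norm0// mulr0.
have := zmin _ (mem_set (unitS _ x0)).
by rewrite NZ normfV normr_id ler_pdivlMl ?normr_gt0// ler_pdivlMl// mulrC.
Qed.

(** The library's [sup] of an unbounded set is 0, so [opnorm] carries
    information only because this set is bounded. *)
Lemma opnorm_has_ubound (R : realType) (n : nat) (N : 'rV[R]_n -> R)
    (A : 'M[R]_n) : is_norm N ->
  has_ubound [set N (v *m A) | v in [set v | N v <= 1]].
Proof.
move=> hN; have [c c0 Nc] := mx_norm_le_is_norm hN.
exists ((\sum_i N (row i A)) * c) => _ [v /= v1 <-].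
apply: le_trans (is_norm_mulmx_le _ _ hN) _.
rewrite ler_wpM2l ?sumr_ge0// => [i _|]; first exact: is_norm_ge0.
by rewrite (le_trans (Nc v))// ler_piMr.
Qed.

Lemma opnorm_ge0 (R : realType) (n : nat) (N : 'rV[R]_n -> R) (A : 'M[R]_n) :
  is_norm N -> 0 <= opnorm N A.
Proof.
move=> hN; apply: ub_le_sup; first exact: opnorm_has_ubound.
by exists 0; rewrite /= ?mul0mx is_norm0.
Qed.

Lemma le_opnorm (R : realType) (n : nat) (N : 'rV[R]_n -> R) (A : 'M[R]_n)
    (v : 'rV[R]_n) : is_norm N -> N (v *m A) <= opnorm N A * N v.
Proof.
move=> hN; have [N0 _ NZ] := hN.
have [/N0 ->|Nv] := eqVneq (N v) 0; first by rewrite mul0mx is_norm0// mulr0.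
have Nv0 : 0 < N v by rewrite lt_neqAle eq_sym Nv is_norm_ge0.
rewrite -ler_pdivrMr// mulrC -[X in X * _]gtr0_norm ?invr_gt0// -NZ scalemxAl.
apply: ub_le_sup; first exact: opnorm_has_ubound.
by exists ((N v)^-1 *: v) => //=; rewrite NZ gtr0_norm ?invr_gt0// mulVf.
Qed.

(** * Inexact Newton steps and the decay of residuals *)

(** Write d = (d *m J) *m invmx J; since d *m J is within e N b <= N b of - b,
    its norm is at most 2 N b. *)
Lemma inexact_newton_step_le (R : realType) (n : nat) (N : 'rV[R]_n -> R)
    (b d : 'rV[R]_n) (J : 'M[R]_n) (a e : R) :
  is_norm N -> J \in unitmx -> opnorm N (invmx J) <= a -> e <= 1 ->
  N (b + d *m J) <= e * N b -> N d <= 2 * a * N b.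
Proof.
move=> hN Ju Ja e1 hd; have [_ ND _] := hN.
have b0 := is_norm_ge0 b hN.
have dJ : N (d *m J) <= 2 * N b.
  rewrite -[d *m J](addKr b) (le_trans (ND _ _))// is_normN// mulr2n mulrDl mul1r.
  by rewrite lerD2l (le_trans hd)// ler_piMl.
rewrite -[d](mulmxK Ju) (le_trans (le_opnorm _ _ hN))// [2 * a]mulrC -mulrA.
by apply: ler_pM => //; [exact: opnorm_ge0|exact: is_norm_ge0].
Qed.

(** With the forcing terms bounded by p (f_(k+1) / f_k) `^ r, the ratios
    K_k = f_(k+1) / f_k `^ r obey a contractive affine recursion
    K_(k+1) <= p K_k + B.  The condition r <= 1 + alpha makes the remainder
    beta f_k `^ (1 + alpha) at most B f_k `^ r, as f is bounded. *)
Lemma forcing_residual_order (R : realType) (f eta : nat -> R)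
    (r alpha beta theta p : R) :
  0 < r <= 1 + alpha -> 0 <= p < 1 -> 0 <= beta ->
  (forall k, 0 <= f k <= theta) ->
  (forall k, eta k.+1 <= p * (f k.+1 / f k) `^ r) ->
  (forall k, f k.+1 <= (eta k + beta * f k `^ alpha) * f k) ->
  exists2 K : R, 0 <= K & forall k, f k.+1 <= K * f k `^ r.
Proof.
move=> /andP[r0 ra] /andP[p0 p1] b0 fth heta hf.
have f0 k : 0 <= f k by case/andP: (fth k).
have fz k : f k = 0 -> f k.+1 = 0.
  by move=> fk; apply/eqP; rewrite eq_le f0 andbT (le_trans (hf k))// fk mulr0.
pose B := beta * theta `^ (1 + alpha - r).
have B0 : 0 <= B by rewrite mulr_ge0 ?powR_ge0.
(* The first ratio, or the fixed point of t |-> p t + B if that is larger. *)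
pose K := Num.max (f 1%N / f 0%N `^ r) (B / (1 - p)).
have K0 : 0 <= K by rewrite le_max divr_ge0 ?powR_ge0.
have BK : p * K + B <= K.
  have : B / (1 - p) <= K by rewrite le_max lexx orbT.
  rewrite ler_pdivrMr ?subr_gt0//; lra.
exists K => //; elim=> [|k IHk].
  have [f00|f00] := eqVneq (f 0%N) 0; first by rewrite fz// mulr_ge0// powR_ge0.
  rewrite -ler_pdivrMr ?le_max ?lexx//.
  by rewrite powR_gt0// lt_neqAle eq_sym f00 f0.
have [fk0|fk0] := eqVneq (f k.+1) 0; first by rewrite fz// mulr_ge0// powR_ge0.
have fk : 0 < f k by rewrite lt_neqAle f0 eq_sym andbT; apply: contra_neq fk0; exact: fz.
apply: le_trans (hf _) _; rewrite mulrDl.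
apply: le_trans (_ : (p * K + B) * f k.+1 `^ r <= _); last first.
  by rewrite ler_wpM2r// powR_ge0.
rewrite mulrDl lerD//.
  rewrite (le_trans (ler_wpM2r (f0 _) (heta k)))// -!mulrA ler_wpM2l//.
  rewrite powRM ?invr_ge0// -powR_inv1// powRAC powR_inv1 ?powR_ge0//.
  rewrite -mulrA [K * _]mulrC ler_wpM2l ?powR_ge0// mulrC.
  by rewrite ler_pdivrMr ?powR_gt0.
rewrite -!mulrA ler_wpM2l//.
have -> : f k.+1 `^ alpha * f k.+1 = f k.+1 `^ (1 + alpha - r) * f k.+1 `^ r.
  rewrite -powRD ?fk0 ?implybT// subrK powRD ?fk0 ?implybT// powRr1//.
  by rewrite mulrC.
rewrite ler_wpM2r ?powR_ge0//.
case/andP: (fth k.+1) => _ fk1; apply: ge0_ler_powR; rewrite ?nnegrE ?subr_ge0//.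
exact: le_trans fk1.
Qed.

Theorem theoremA1 (R : realType) (n : nat) (N : 'rV[R]_n -> R)
    (D : set 'rV[R]_n) (F : 'rV[R]_n -> 'rV[R]_n) (ustar : 'rV[R]_n)
    (C alpha M xistar mu beta xi : R)
    (r : R) (phi : nat -> R) (theta : R)
    (eta : nat -> R) (delta u : nat -> 'rV[R]_n)
    (* standing assumptions; F is only meaningful on its domain D *)
    (hN : is_norm N)
    (hroot : F ustar = 0)
    (hC : 0 <= C) (halpha : 0 <= alpha)
    (hM : M = Num.max (opnorm N ('J F ustar)) (opnorm N (invmx ('J F ustar))))
    (hxistar : 0 < xistar)
    (hD : nball N ustar xistar `<=` D)
    (hdiff : forall v, nball N ustar xistar v ->
       differentiable F v /\ {for v, continuous (fun w => 'J F w)})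
    (hunit : forall v, nball N ustar xistar v -> 'J F v \in unitmx)
    (hHolder : forall v, nball N ustar xistar v ->
       opnorm N ('J F v - 'J F ustar) <= C * N (v - ustar) `^ alpha)
    (hinv : forall v, nball N ustar xistar v ->
       opnorm N (invmx ('J F v)) <= (alpha + 1) * M)
    (* xistar < (alpha + 1) / (C M), vacuous when C = 0 *)
    (hxistarC : xistar * (C * M) < alpha + 1)
    (* constants *)
    (hmu : 0 < mu)
    (hmuF : forall v, nball N ustar xistar v ->
       mu^-1 * N (v - ustar) <= N (F v) <= mu * N (v - ustar))
    (hbeta : 0 < beta)
    (hbetaF : forall (v d : 'rV[R]_n) (e : R),
       nball N ustar xistar v -> D (v + d) -> 0 <= e < 1 ->
       N (F v + d *m 'J F v) <= e * N (F v) ->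
       N (F (v + d)) <= (e + beta * N (F v) `^ alpha) * N (F v))
    (hxi : 0 < xi <= xistar / (1 + 2 * (alpha + 1) * M * mu))
    (* data of the method *)
    (hr : 1 < r <= 2)
    (hphi : nonincreasing_seq phi) (hphi0 : phi 0%N < 1)
    (heta0 : 0 <= eta 0%N < 1)
    (hu0 : nball N ustar xi (u 0%N))
    (htheta : 0 < theta)
    (htheta_eta : eta 0%N + beta * theta `^ alpha <= eta 0%N `^ r^-1)
    (htheta_xi : theta < xi / mu)
    (htheta_u0 : N (F (u 0%N)) <= theta)
    (hnewton : inexact_newton N F eta delta u)
    (heta : forall k : nat,
       eta k.+1 = phi k.+1 * (N (F (u k.+1)) / N (F (u k))) `^ r) :
  (forall k : nat, 0 <= eta k < 1) /\
  (forall k : nat, nball N ustar xistar (u k)) /\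
  u @ \oo --> ustar /\
  (r <= 1 + alpha -> q_order N u ustar r).
Proof.
have [_ ND _] := hN.
set f := fun k => N (F (u k)).
have f0 k : 0 <= f k by exact: is_norm_ge0.
have r0 : 0 < r by lra.
have M0 : 0 <= M by rewrite hM le_max opnorm_ge0.
have /andP[xi0] := hxi.
set s := 1 + _ => xis.
have s1 : 1 <= s by rewrite lerDl !mulr_ge0// ?addr_ge0// ltW.
have s0 : 0 < s by lra.
have xixi : xi * s <= xistar by rewrite -ler_pdivlMr.
have xile : xi <= xistar by rewrite (le_trans _ xixi)// ler_peMr// ltW.
have thxi : mu * theta < xi by rewrite mulrC -ltr_pdivlMr.
have bth : 0 < beta * theta `^ alpha by rewrite mulr_gt0// powR_gt0.
(* For eta_0 = 0 the condition on theta would read beta theta `^ alpha <= 0. *)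
have eta0 : 0 < eta 0%N.
  rewrite lt_neqAle; case/andP: heta0 => -> _; rewrite andbT.
  apply/eqP => e0; move: htheta_eta; rewrite -e0 add0r powR0 ?invr_eq0 ?gt_eqF//.
  by rewrite leNgt bth.
set q := eta 0%N `^ r^-1 in htheta_eta.
have q0 : 0 < q by rewrite powR_gt0.
have q1 : q < 1.
  have <- : 1 `^ r^-1 = 1 :> R by rewrite powR1.
  rewrite gt0_ltr_powR ?invr_gt0 ?nnegrE//; last by case/andP: heta0.
  exact: ltW.
have qr : q `^ r = eta 0%N by rewrite -powRrM mulVf ?gt_eqF// powRr1// ltW.
have err_le k : nball N ustar xistar (u k) -> N (u k - ustar) <= mu * f k.
  by move=> /hmuF /andP[+ _]; rewrite ler_pdivrMl.
have eta1 k : 0 <= eta k <= eta 0%N -> 0 <= eta k < 1.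
  by case/andP: heta0 => _ e1 /andP[-> /le_lt_trans ->].
have inv k : [/\ nball N ustar xi (u k), f k <= theta * q ^+ k
                & 0 <= eta k <= eta 0%N].
  elim: k => [|k [uk fk ek]].
    by rewrite expr0 mulr1 lexx andbT; split=> //; exact: ltW.
  have fkth : f k <= theta.
    by rewrite (le_trans fk)// ler_piMr ?exprn_ile1// ltW.
  have ukx : nball N ustar xistar (u k) by exact: lt_le_trans uk xile.
  have ek1 := eta1 k ek.
  have [hk uS] := hnewton k.
  have dk : N (delta k) <= 2 * ((alpha + 1) * M) * f k.
    apply: inexact_newton_step_le hk => //; [exact: hunit|exact: hinv|].
    by case/andP: ek1 => _ /ltW.
  have uSx : nball N ustar xistar (u k.+1).
    (* The estimate of F at u k.+1 requires that point to lie in D, so the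
       length of the step is bounded first. *)
    rewrite /nball /= uS addrAC (le_lt_trans (ND _ _))//.
    apply: lt_le_trans xixi.
    apply: le_lt_trans (_ : N (u k - ustar) * s < _); last by rewrite ltr_pM2r.
    rewrite mulrDr mulr1 lerD2l (le_trans dk)//.
    rewrite [leRHS](_ : _ = 2 * ((alpha + 1) * M) * (mu * N (u k - ustar))).
      by rewrite ler_wpM2l ?mulr_ge0 ?addr_ge0//; case/andP: (hmuF _ ukx).
    by ring.
  have fS : f k.+1 <= q * f k.
    have /= := hbetaF (u k) (delta k) (eta k) ukx.
    rewrite -uS => /(_ (hD _ uSx) ek1 hk) /le_trans; apply.
    rewrite (ler_wpM2r (f0 k))// (le_trans _ htheta_eta)// lerD//; first by case/andP: ek.
    rewrite ler_wpM2l ?(ltW hbeta)//.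
    by apply: (ge0_ler_powR halpha _ _ fkth); [exact: f0|exact: ltW].
  have fSk : f k.+1 <= theta * q ^+ k.+1.
    by rewrite (le_trans fS)// exprS mulrCA ler_wpM2l// ltW.
  split=> //.
    rewrite /nball /= (le_lt_trans (err_le _ uSx))// (le_lt_trans _ thxi)//.
    by rewrite ler_pM2l// (le_trans fSk)// ler_piMr ?exprn_ile1// ltW.
  have t0 : 0 <= f k.+1 / f k by exact: divr_ge0.
  have tq : (f k.+1 / f k) `^ r <= eta 0%N.
    rewrite -qr; apply: ge0_ler_powR; rewrite ?nnegrE//; [exact: ltW|exact: ltW|].
    have [->|fk0] := eqVneq (f k) 0; first by rewrite invr0 mulr0 ltW.
    by rewrite ler_pdivrMr// lt_neqAle eq_sym fk0 f0.
  (* phi may become negative; but the Newton inequality at k + 1 gives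
     0 <= eta_(k+1) f_(k+1), and eta_(k+1) = 0 when f_(k+1) = 0. *)
  apply/andP; split.
    have [fS0|fS0] := eqVneq (f k.+1) 0.
      by rewrite heta -/(f _) fS0 mul0r powR0 ?mulr0// gt_eqF.
    have fS1 : 0 < f k.+1 by rewrite lt_neqAle eq_sym fS0 f0.
    have [hkS _] := hnewton k.+1.
    by rewrite -(pmulr_lge0 _ fS1) (le_trans _ hkS)// is_norm_ge0.
  rewrite heta -/(f _) -/(f _) (le_trans _ tq)// ler_piMl ?powR_ge0//.
  by rewrite (le_trans (hphi _ _ (leq0n _)))// ltW.
have ukx k : nball N ustar xistar (u k).
  by have [uk _ _] := inv k; exact: lt_le_trans uk xile.
have etak k : 0 <= eta k < 1 by have [_ _ /eta1] := inv k.
have fth k : 0 <= f k <= theta.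
  have [_ fk _] := inv k.
  by rewrite f0 (le_trans fk)// ler_piMr ?exprn_ile1// ltW.
split=> //; split=> //; split.
  have [c c0 Nc] := mx_norm_le_is_norm hN.
  apply/cvgrPdist_le => e e0.
  have /cvgrPdist_le/(_ e e0) : geometric (c * (mu * theta)) q @ \oo --> (0 : R).
    by apply: cvg_geometric; rewrite gtr0_norm.
  apply: filterS => k; rewrite sub0r normrN => ke.
  apply: le_trans (le_trans (ler_norm _) ke).
  rewrite distrC (le_trans (Nc _))// /= -!mulrA ler_wpM2l//.
  have [_ fk _] := inv k.
  by rewrite (le_trans (err_le _ (ukx k)))// ler_pM2l.
move=> ra.
(* phi 0 itself may be negative. *)
pose p := Num.max (phi 0%N) 0.
have [||||||K K0 fK] := @forcing_residual_order R f eta r alpha beta theta p.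
- by rewrite r0.
- by rewrite le_max lexx orbT gt_max hphi0 ltr01.
- exact: ltW.
- exact: fth.
- move=> k; rewrite heta ler_wpM2r ?powR_ge0// le_max.
  by rewrite (hphi _ _ (leq0n _)).
- move=> k; have [hk uS] := hnewton k.
  have := hbetaF (u k) (delta k) (eta k) (ukx k).
  by rewrite -uS; apply => //; exact: hD.
exists (mu * (K * mu `^ r)); first by rewrite !mulr_ge0 ?powR_ge0// ltW.
near=> k.
rewrite (le_trans (err_le _ (ukx _)))// -!mulrA ler_pM2l//.
rewrite (le_trans (fK k))// ler_wpM2l// -powRM ?is_norm_ge0 ?(ltW hmu)//.
have /andP[_ fk] := hmuF _ (ukx k).
apply: ge0_ler_powR => //; rewrite ?nnegrE ?mulr_ge0 ?is_norm_ge0//; exact: ltW.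
Unshelve. all: by end_near. Qed.
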